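(* Let $n, m$ be positive integers and let $\alpha \ge 0$ be a real number. If $$m \ge n^{2+\alpha},$$ then $$g_2(n,m) \le 4\, n^{2-2\alpha}.$$
   Context: The 2-girth of a finite 2-dimensional simplicial complex $X$ is the minimum number of 2-faces in (the support of) a non-zero 2-cycle of $X$ with coefficients in $\mathbb{Z}/2$; it is $\infty$ if $X$ has no non-zero 2-cycle. $g_2(n,m)$ denotes the maximum possible 2-girth of a 2-dimensional simplicial complex with $n$ vertices and $m$ 2-faces. Thus the inequality $g_2(n,m) \le B$ means that every 2-dimensional simplicial complex with $n$ vertices and $m$ 2-faces has a non-zero 2-cycle over $\mathbb{Z}/2$ supported on at most $B$ faces. *)

(* Defs.v *)
From HB Require Import structures.
From mathcomp Require Import all_boot all_order all_algebra.

Set Implicit Arguments.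
Unset Strict Implicit.
Unset Printing Implicit Defensive.

Import GRing.Theory.
Local Open Scope ring_scope.

(* A face is a nonempty set of elements of V; an element x of V is a vertex of
   the complex only when [set x] is a face. *)
Record complex (V : finType) := Complex {
  faces :> {set {set V}};
  faces_neq0 : forall s : {set V}, s \in faces -> s != set0;
  faces_down : forall s t : {set V},
    s \in faces -> t \subset s -> t != set0 -> t \in faces
}.

Section Chains.
Variables (V : finType) (X : complex V).

Definition kfaces (k : nat) : {set {set V}} :=
  [set s : {set V} in faces X | #|s| == k.+1].

Definition has_dimension (d : nat) : Prop :=
  (exists s : {set V}, s \in kfaces d) /\
  (forall s : {set V}, s \in faces X -> (#|s| <= d.+1)%N).

(* C_k(X; Z/2) consists of the coefficient functions supported on the
   k-faces. *)
Definition is_chain (k : nat) (c : {ffun {set V} -> 'F_2}) : Prop :=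
  forall s : {set V}, c s != 0 -> s \in kfaces k.

(* The boundary map from (k+1)-chains to k-chains: modulo 2 the usual signs
   disappear, so the coefficient of a k-face is the sum of the coefficients of
   the (k+1)-faces containing it. *)
Definition boundary (k : nat) (c : {ffun {set V} -> 'F_2}) :
    {ffun {set V} -> 'F_2} :=
  [ffun s : {set V} => if s \in kfaces k
     then \sum_(t in kfaces k.+1 | s \subset t) c t else 0].

Definition is_2cycle (c : {ffun {set V} -> 'F_2}) : Prop :=
  is_chain 2 c /\ boundary 1 c = 0.

Definition chain_support (c : {ffun {set V} -> 'F_2}) : {set {set V}} :=
  [set s : {set V} | c s != 0].

End Chains.

From mathcomp Require Import all_classical all_reals all_analysis.

Local Open Scope classical_set_scope.
Local Open Scope ereal_scope.

(* The infimum of the empty set is +oo, which is the value for complexes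
   without a nonzero 2-cycle. *)
Definition girth2 (R : realType) (V : finType) (X : complex V) : \bar R :=
  ereal_inf [set x : \bar R | exists c : {ffun {set V} -> 'F_2},
    [/\ is_2cycle X c, c <> 0%R & x = (#|chain_support c|%:R)%:E]].

(* When no complex has n vertices and m 2-faces this is -oo, so that an upper
   bound on g2 n m is exactly an upper bound on the 2-girth of every such
   complex; otherwise the supremum is a maximum, since up to isomorphism there
   are only finitely many such complexes. *)
Definition g2 (R : realType) (n m : nat) : \bar R :=
  ereal_sup [set x : \bar R | exists (V : finType) (X : complex V),
    [/\ has_dimension X 2, #|kfaces X 0| = n, #|kfaces X 2| = m
      & x = girth2 R X]].

(* Main.v *)
Require Import Defs.
From HB Require Import structures.
From mathcomp Require Import all_boot all_order all_algebra.
From mathcomp Require Import all_classical all_reals all_analysis.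
From mathcomp Require Import zify ring lra.
Import boot.fintype boot.finset.

(** Restrict the complex to a suitable small set of vertices, where counting
    alone forces a cycle.  Averaging over all [s]-subsets of the [n] vertices
    ([dense_subset]) gives a set [S] that contains at least the proportion
    ['C(s, 3) / 'C(n, 3)] of the [m] triangles.  The number of triangles
    shrinks like [s ^ 3], but the number ['C(s, 2)] of pairs in [S] only like
    [s ^ 2]; the two balance at [s] of order [n ^ 3 / m <= n ^ (1 - alpha)].
    As soon as there are more triangles than pairs inside [S], the boundary
    map over Z/2 cannot be injective on the chains carried by
    ['C(s, 2) + 1] of these triangles ([short_cycle]), which yields a nonzero
    cycle with at most ['C(s, 2) + 1] faces, a quantity of order
    [n ^ (2 - 2 alpha)].

    The constants work out for [s] the integral part of
    [x = n ^ (1 - alpha)]: since [m <= 'C(n, 3)], one has [6 <= x], so that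
    [s - 2 > x / 2] and hence [2 m (s - 2) > n ^ 3]; this is the inequality
    needed for [S] to contain more triangles than pairs. *)

Import Order.TTheory GRing.Theory Num.Theory.
Local Open Scope ring_scope.

Lemma card_supersets (T : finType) (t W : {set T}) (s : nat) :
  t \subset W -> (#|t| <= s)%N ->
  ('C(#|W| - #|t|, s - #|t|) <=
     #|[set S : {set T} | [&& S \subset W, #|S| == s & t \subset S]]|)%N.
Proof.
move=> tW ts.
have -> : (#|W| - #|t|)%N = #|W :\: t|.
  by rewrite cardsD (setIidPr tW).
rewrite -cards_draws -(card_in_imset (f := fun B : {set T} => B :|: t)).
  apply: subset_leq_card; apply/subsetP => S /imsetP[B].
  rewrite !inE subsetD => /andP[/andP[BW dBt] /eqP cB] ->.
  rewrite subUset BW tW subsetUr andbT /=.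
  by rewrite cardsU (disjoint_setI0 dBt) cards0 subn0 cB subnK // eqxx.
move=> A B; rewrite !inE !subsetD => /andP[/andP[_ dA] _] /andP[/andP[_ dB] _].
move=> /(congr1 (fun Z => Z :\: t)).
by rewrite !setDUl !setDv !setU0 (setDidPl dA) (setDidPl dB).
Qed.

Lemma mul_bin_sub (n s k : nat) : (k <= s <= n)%N ->
  ('C(n, s) * 'C(s, k) = 'C(n, k) * 'C(n - k, s - k))%N.
Proof.
move=> /andP[ks sn]; have kn := leq_trans ks sn.
have pos : (0 < k`! * (s - k)`! * (n - s)`!)%N by rewrite !muln_gt0 !fact_gt0.
apply/eqP; rewrite -(eqn_pmul2r pos); apply/eqP.
have E1 := bin_fact sn; have E2 := bin_fact ks; have E3 := bin_fact kn.
have E4 := @bin_fact (n - k) (s - k) (leq_sub2r _ sn).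
have E : (n - k - (s - k) = n - s)%N by lia.
rewrite E in E4.
transitivity n`!; first by rewrite -E1 -E2; ring.
by rewrite -E3 -E4; ring.
Qed.

(** The average over the [s]-subsets [S] of [W] of the proportion of the
    [k]-subsets of [S] that belong to [F] is the density of [F] among the
    [k]-subsets of [W], so some [S] attains at least this density. *)
Lemma dense_subset (T : finType) (W : {set T}) (F : {set {set T}})
    (k s : nat) :
  (forall t, t \in F -> t \subset W /\ #|t| = k) -> (k <= s <= #|W|)%N ->
  exists S : {set T}, [/\ S \subset W, #|S| = s &
    (#|F| * 'C(s, k) <= #|[set t in F | t \subset S]| * 'C(#|W|, k))%N].
Proof.
move=> FW ksn; have /andP[ks sn] := ksn.
pose D := [set S : {set T} | S \subset W & #|S| == s].
have cD : #|D| = 'C(#|W|, s) by rewrite cards_draws.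
pose dens (S : {set T}) := #|[set t in F | t \subset S]|.
have count : (#|F| * 'C(#|W| - k, s - k) <= \sum_(S in D) dens S)%N.
  have -> : (\sum_(S in D) dens S =
             \sum_(t in F) #|[set S in D | t \subset S]|)%N.
    under eq_bigr => S _ do rewrite /dens -sum1dep_card big_mkcondr /=.
    rewrite exchange_big /=; apply: eq_bigr => t _.
    by rewrite -big_mkcondr /= sum1dep_card.
  rewrite -sum_nat_const; apply: leq_sum => t /FW[tW ct].
  have := @card_supersets T t W s tW; rewrite ct => /(_ ks) /leq_trans; apply.
  apply: subset_leq_card; apply/subsetP => S.
  by rewrite !inE => /and3P[-> -> ->].
have [/existsP[S /andP[SD hS]]|] :=
    boolP [exists S, (S \in D) && (#|F| * 'C(s, k) <= dens S * 'C(#|W|, k))%N].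
  by exists S; move: SD; rewrite inE => /andP[SW /eqP cS].
rewrite negb_exists => /forallP none; exfalso.
have D0 : (0 < #|D|)%N by rewrite cD bin_gt0.
have ltD : (\sum_(S in D) (dens S * 'C(#|W|, k)).+1 <=
            \sum_(S in D) (#|F| * 'C(s, k)))%N.
  apply: leq_sum => S SD.
  by have := none S; rewrite SD /= -ltnNge.
move: ltD; under eq_bigr => S _ do rewrite -addn1.
rewrite big_split /= -big_distrl /= !sum_nat_const muln1.
have := leq_mul count (leqnn 'C(#|W|, k)).
have := @mul_bin_sub _ _ _ ksn; rewrite -cD => E.
have -> : (#|D| * (#|F| * 'C(s, k)) =
           #|F| * 'C(#|W| - k, s - k) * 'C(#|W|, k))%N.
  by rewrite mulnCA E; ring.
move=> h1 h2; have := leq_trans h2 h1.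
by rewrite -[X in (_ <= X)%N]addn0 leq_add2l leqNgt D0.
Qed.

Lemma boundaryB (V : finType) (X : complex V) (k : nat)
    (c d : {ffun {set V} -> 'F_2}) :
  boundary X k (c - d) = boundary X k c - boundary X k d.
Proof.
apply/ffunP => e; rewrite !ffunE; case: ifP => _; last by rewrite subr0.
by rewrite -sumrB; apply: eq_bigr => t _; rewrite !ffunE.
Qed.

(** Pigeonhole in place of a rank argument: the collections of chosen faces
    outnumber the sets of pairs (for [k = 1]) that can be the boundary of one,
    so two collections have the same boundary, and their difference is a
    cycle.  Choosing only ['C(#|S|, k.+1) + 1] faces of [F] beforehand is what
    keeps the cycle short. *)
Lemma short_cycle (V : finType) (X : complex V) (k : nat) (S : {set V})
    (F : {set {set V}}) :
  (forall t, t \in F -> t \in kfaces X k.+1 /\ t \subset S) ->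
  ('C(#|S|, k.+1) < #|F|)%N ->
  exists c : {ffun {set V} -> 'F_2},
    [/\ is_chain X k.+1 c, boundary X k c = 0, c <> 0 &
        (#|chain_support c| <= 'C(#|S|, k.+1).+1)%N].
Proof.
move=> FS big.
pose G := [set t in take 'C(#|S|, k.+1).+1 (enum F)].
have GF t : t \in G -> t \in F by rewrite inE => /mem_take; rewrite mem_enum.
have cG : #|G| = 'C(#|S|, k.+1).+1.
  rewrite cardsE (card_uniqP _) ?take_uniq ?enum_uniq //.
  by rewrite size_take_min -cardE; apply/minn_idPl.
pose ind (A : {set {set V}}) : {ffun {set V} -> 'F_2} :=
  [ffun t => (t \in A)%:R].
have ind_neq0 A t : (ind A t != 0) = (t \in A).
  by rewrite ffunE; case: (t \in A).
pose E := [set e : {set V} | e \subset S & #|e| == k.+1].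
pose bd (A : {set {set V}}) := [set e | boundary X k (ind A) e != 0].
have bdE A : A \in powerset G -> bd A \in powerset E.
  rewrite !inE => /subsetP AG; apply/subsetP => e.
  rewrite !inE ffunE; case: ifP => [ek|_]; last by rewrite eqxx.
  move=> nz; move: ek; rewrite inE => /andP[_ ->]; rewrite andbT.
  apply: contraNT nz => neS; rewrite big1 // => t /andP[_ et].
  apply/eqP/negPn; rewrite ind_neq0; apply: contra neS => tA.
  by have [_ tS] := FS _ (GF _ (AG _ tA)); apply: subset_trans et tS.
have /dinjectivePn[A AG [B BG eqAB]] : ~~ dinjectiveb bd (powerset G).
  apply/negP => /dinjectiveP inj.
  have : (#|powerset G| <= #|powerset E|)%N.
    rewrite -(card_in_imset inj); apply: subset_leq_card.
    by apply/subsetP => _ /imsetP[A AG ->]; apply: bdE.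
  by rewrite !card_powerset cG cards_draws leq_exp2l // ltnn.
move: BG; rewrite !inE => /andP[AB BG]; rewrite inE in AG.
have suppG t : (ind A - ind B) t != 0 -> t \in G.
  apply: contraR => nG; rewrite !ffunE.
  rewrite (contraNF ((subsetP AG) t) nG).
  by rewrite (contraNF ((subsetP BG) t) nG) subrr.
(* An element of the two-element field is determined by whether it is 0. *)
have F2_eq (a b : 'F_2) : (a != 0) = (b != 0) -> a = b.
  case: a b => [[|[|a]] pa] [[|[|b]] pb] //= h; try exact: val_inj.
exists (ind A - ind B); split.
- by move=> t /suppG /GF /FS[].
- apply/eqP; rewrite boundaryB subr_eq0; apply/eqP/ffunP => e; apply: F2_eq.
  by have := congr1 (fun Z : {set {set V}} => e \in Z) eqAB; rewrite !inE.
- move=> /eqP; rewrite subr_eq0 => /eqP eqI; move/eqP: AB; apply.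
  by apply/setP => t; rewrite -!ind_neq0 eqI.
- rewrite -cG; apply: subset_leq_card; apply/subsetP => t.
  by rewrite inE => /suppG.
Qed.

Definition vertices {V : finType} (X : complex V) : {set V} :=
  [set v | [set v] \in faces X].

Lemma card_vertices (V : finType) (X : complex V) :
  #|vertices X| = #|kfaces X 0|.
Proof.
rewrite -(card_imset (mem (vertices X)) (@set1_inj V)).
apply: eq_card => s; rewrite !inE; apply/imsetP/andP => [[v vX ->]|].
  by move: vX; rewrite !inE cards1.
move=> [sX /cards1P[v ev]]; exists v => //.
by rewrite inE -ev.
Qed.

Lemma kface_vertices (V : finType) (X : complex V) (k : nat) (t : {set V}) :
  t \in kfaces X k -> t \subset vertices X /\ #|t| = k.+1.
Proof.
rewrite inE => /andP[tX /eqP ct]; split=> //.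
apply/subsetP => v vt; rewrite inE; apply: (faces_down tX).
  by rewrite sub1set.
by apply/set0Pn; exists v; rewrite inE.
Qed.

Lemma card_kfaces_le (V : finType) (X : complex V) (k : nat) :
  (#|kfaces X k| <= 'C(#|kfaces X 0|, k.+1))%N.
Proof.
rewrite -card_vertices -cards_draws; apply: subset_leq_card.
by apply/subsetP => t /kface_vertices[tW ct]; rewrite inE tW ct eqxx.
Qed.

(** The hypothesis on [s] says that the complex has more than
    ['C(s, 2) * 'C(n, 3) / 'C(s, 3)] triangles, that is, enough for an
    [s]-subset of average density to carry more than ['C(s, 2)] of them. *)
Lemma cycle_of_density (V : finType) (X : complex V) (s : nat) :
  (3 <= s <= #|kfaces X 0|)%N ->
  (3 * 'C(#|kfaces X 0|, 3) < #|kfaces X 2| * (s - 2))%N ->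
  exists c : {ffun {set V} -> 'F_2},
    [/\ is_2cycle X c, c <> 0 & (#|chain_support c| <= 'C(s, 2).+1)%N].
Proof.
rewrite -card_vertices => hs dense; have /andP[s3 sn] := hs.
have [S [SW cS avg]] := @dense_subset V (vertices X) (kfaces X 2) 3 s
                          (@kface_vertices V X 2) hs.
have [||c [chn bc nz sz]] :=
    @short_cycle V X 1 S [set t in kfaces X 2 | t \subset S].
- by move=> t; rewrite inE => /andP[].
- rewrite cS ltnNge; apply/negP => few.
  have E : (3 * 'C(s, 3) = (s - 2) * 'C(s, 2))%N.
    by rewrite mul_bin_left.
  have C0 : (0 < 'C(s, 2))%N by rewrite bin_gt0; lia.
  have : (#|kfaces X 2| * (s - 2) * 'C(s, 2) <=
          3 * 'C(#|vertices X|, 3) * 'C(s, 2))%N.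
    rewrite -mulnA -E mulnCA -mulnA leq_mul2l /=.
    by apply: leq_trans avg _; rewrite mulnC leq_mul2l few orbT.
  by rewrite leq_pmul2r // leqNgt dense.
- by exists c; rewrite -cS; split.
Qed.

Lemma bin3_le (n : nat) : (6 * 'C(n, 3) <= n ^ 3)%N.
Proof.
rewrite -[6%N]/(3`!) mulnC bin_ffact !ffactnS ffactn0 muln1.
by case: n => [|[|n]] //=; rewrite !expnS expn0; nia.
Qed.

Lemma bin2_lt_sqr (s : nat) : (0 < s)%N -> ('C(s, 2) < s ^ 2)%N.
Proof.
move=> s0; have := mul_bin_diag s 1; rewrite bin1.
by rewrite expnS expn1; nia.
Qed.

Theorem theorem3p1 (R : realType) (n m : nat) (alpha : R)
  (hn : (0 < n)%N) (hm : (0 < m)%N) (halpha : 0 <= alpha)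
  (hnm : n%:R `^ (2 + alpha) <= m%:R) :
  (g2 R n m <= (4 * n%:R `^ (2 - 2 * alpha))%:E)%E.
Proof.
apply: ge_ereal_sup => _ [V [X [_ cn cm ->]]].
have n0 : (0 : R) < n%:R by rewrite ltr0n.
pose x : R := n%:R `^ (1 - alpha); pose y : R := n%:R `^ (2 + alpha).
have y0 : 0 < y by rewrite powR_gt0.
have x0 : 0 <= x by exact: powR_ge0.
have yx : y * x = n%:R ^+ 3.
  rewrite /x /y -powRD ?(gt_eqF n0) ?implybT // -powR_mulrn ?ler0n //.
  by congr (_ `^ _); lra.
have x2 : n%:R `^ (2 - 2 * alpha) = x ^+ 2.
  rewrite /x -powR_mulrn ?powR_ge0 // -powRrM.
  by congr (_ `^ _); lra.
have xn : x <= n%:R.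
  rewrite /x -[leRHS]powRr1 ?ler0n //; apply: ler_powR; last lra.
  by rewrite ler1n.
have m6 : (6 * m <= n ^ 3)%N.
  apply: leq_trans (bin3_le n); rewrite leq_mul2l /= -cm -cn.
  exact: card_kfaces_le.
have x6 : 6 <= x.
  move: m6; rewrite -(ler_nat R) natrM natrX -yx => m6.
  rewrite -(ler_pM2l y0); apply: le_trans m6.
  by rewrite mulrC ler_pM2l.
(* From [6 <= x < s + 1] one gets [x < 2 (s - 2)], which is what [dense] needs. *)
pose s := Num.trunc x.
have /andP[sx xs] := truncn_itv x0.
rewrite -/s -natr1 in sx xs.
have s5 : (5 < s)%N.
  by rewrite -(ltr_nat R); lra.
have sn : (s <= n)%N by rewrite -(ler_nat R); apply: le_trans sx xn.
have dense : (n ^ 3 < 2 * (m * (s - 2)))%N.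
  rewrite -(ltr_nat R) natrX -yx !natrM natrB; last by lia.
  apply: (@lt_le_trans _ _ (2 * (y * (s%:R - 2)))).
    by rewrite mulrCA ltr_pM2l //; lra.
  rewrite ler_pM2l // ler_wpM2r //.
  by rewrite subr_ge0 ler_nat; lia.
have [||c [cyc nz sz]] := @cycle_of_density V X s.
- by rewrite cn; lia.
- by rewrite cn cm; have := bin3_le n; lia.
apply: le_trans (_ : ((#|chain_support c|%:R)%:E <= _)%E).
  by apply: ereal_inf_lbound; exists c.
rewrite lee_fin x2.
apply: (@le_trans _ _ (s%:R ^+ 2)).
  rewrite -natrX ler_nat; apply: leq_trans sz (bin2_lt_sqr _ _); lia.
have : (s%:R : R) ^+ 2 <= x ^+ 2 by rewrite ler_pXn2r // nnegrE.
by have := sqr_ge0 x; lra.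
Qed.
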